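(* Let $n\ge1$ be an integer and let $z_1,\ldots,z_n$ be complex numbers with $|z_k|=1$. Put $S(\nu)=\sum_{k=1}^n z_k^\nu$ and $e(x)=e^{2\pi i x}$. Then the following are equivalent: (i) $|S(\nu)|=\sqrt{n-1}$ for all $\nu=1,\ldots,n^2-n$; (ii) there exist a complex number $\alpha$ with $|\alpha|=1$ and a perfect difference set $(a_1,\ldots,a_n)$ of order $n-1$ such that $z_k=\alpha\, e\!\left(\frac{a_k}{n^2-n+1}\right)$ for $k=1,\dots,n$. Moreover, if (i) and (ii) are false, then $\max_{\nu=1,\ldots,n^2-n}|S(\nu)|>\sqrt{n-1}$.
   Context: A perfect difference set of order $q$ is a tuple of integers $(a_1,\ldots,a_{q+1})$ such that the differences $a_i-a_j$ with $i\ne j$ represent all nonzero residues modulo $q^2+q+1$. *)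

(* Defs.v *)
From mathcomp Require Import all_boot all_order all_algebra.
From mathcomp Require Import reals trigo.
From mathcomp Require Import complex.

Set Implicit Arguments.
Unset Strict Implicit.
Unset Printing Implicit Defensive.

Import Order.TTheory GRing.Theory Num.Theory.
Import ComplexField.Normc.
Local Open Scope ring_scope.
Local Open Scope complex_scope.

(* e^(2 pi i x) for real x, by Euler's formula. *)
Definition e (R : realType) (x : R) : R[i] :=
  cos (2 * pi * x) +i* sin (2 * pi * x).

Definition powersum (R : realType) (n : nat) (z : 'I_n -> R[i]) (nu : nat) :
    R[i] :=
  \sum_(k < n) z k ^+ nu.

(* As there are q ^ 2 + q pairs i != j, covering the nonzero residues forces
   each of them to be represented exactly once. *)
Definition perfect_difference_set (q : nat) (a : q.+1.-tuple int) : Prop :=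
  forall r : int, ~~ ((q ^ 2 + q + 1)%N%:Z %| r)%Z ->
    exists i j : 'I_q.+1,
      i != j /\ (tnth a i - tnth a j = r %[mod (q ^ 2 + q + 1)%N%:Z])%Z.

(* The modulus |w| as an element of R; the library norm `|w| lives in R[i],
   and `|w| = (cabs w)%:C. *)
Definition cabs (R : realType) (w : R[i]) : R := normc w.

(* All terms are nonnegative, so the seed 0 does not affect a nonempty maximum. *)
Definition max_powersum (R : realType) (n : nat) (z : 'I_n -> R[i]) (N : nat) :
    R :=
  \big[Num.max/0]_(1 <= nu < N.+1) cabs (powersum z nu).

(* Main.v *)
Require Import Defs.
From mathcomp Require Import all_boot all_order all_algebra.
From mathcomp Require Import reals trigo complex zify ring lra.

(* Write [M = n^2 - n + 1]. Expanding [|S(nu)|^2] gives the power sums of the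
   [n^2 - n] ratios [z_j / z_k], [j <> k]; adjoin the ratio [1] to get [M] numbers
   [w], whose [nu]-th power sum is [|S(nu)|^2 - (n - 1)]. If these are all [<= 0]
   for [1 <= nu < M], Newton's identities make the coefficients of
   [P = \prod (1 - w X)] of degree [< M] nonnegative. The constant coefficient is
   [1], the leading one is [-1] and [P(1) = 0], so [P = 1 - X^M]: the [w] are
   exactly the [M]-th roots of unity, which is (ii). *)

Set Implicit Arguments.
Unset Strict Implicit.
Unset Printing Implicit Defensive.

Import Order.TTheory GRing.Theory Num.Theory.
Local Open Scope ring_scope.
Local Open Scope complex_scope.

(** * Power sums and the coefficients of [\prod (1 - w X)] *)

(** Compare the coefficients of ['X^m] in [P' = - P * \sum w / (1 - w X)], each fraction being a
    geometric series. *)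
Lemma newton_identity (F : comNzRingType) (I : Type) (r : seq I) (D : pred I)
    (w : I -> F) (P := \prod_(i <- r | D i) (1 - (w i)%:P * 'X)) (m : nat) :
  P`_m.+1 *+ m.+1 =
  - \sum_(l < m.+1) (\sum_(i <- r | D i) w i ^+ l.+1) * P`_(m - l).
Proof.
(* [g x] truncates the series of [x / (1 - x X)]; the remainder in [gE] is a multiple of
   ['X^(m.+1)], invisible to the coefficient of ['X^m]. *)
pose g x : {poly F} := \poly_(l < m.+1) x ^+ l.+1.
have gE x : (1 - x%:P * 'X) * g x = x%:P - (x ^+ m.+2)%:P * 'X^(m.+1).
  rewrite /g poly_def; under eq_bigr => l _ do rewrite -mul_polyC.
  elim: m {g} => [|k IHk].
    by rewrite big_ord1 /= expr2 !polyCM expr1; ring.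
  by rewrite big_ord_recr mulrDr IHk /= !exprS !polyCM; ring.
(* The logarithmic derivative of [P], cleared of denominators modulo ['X^(m.+1)]. *)
have [Q PQ] : exists Q, P^`() + P * \sum_(i <- r | D i) g (w i) = 'X^(m.+1) * Q.
  rewrite /P; elim: r {P} => [|i r [Q IHr]].
    by exists 0; rewrite !big_nil derivC mulr0 addr0 mulr0.
  rewrite !big_cons; case: (D i); last by exists Q.
  set P := \prod_(_ <- _ | _) _ in IHr *; set G := \sum_(_ <- _ | _) _ in IHr *.
  exists ((1 - (w i)%:P * 'X) * Q - (w i ^+ m.+2)%:P * P).
  rewrite derivM derivB derivM !derivC derivX mul0r !add0r mulr1.
  have -> : - (w i)%:P * P + (1 - (w i)%:P * 'X) * P^`() +
      (1 - (w i)%:P * 'X) * P * (g (w i) + G) =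
      (1 - (w i)%:P * 'X) * (P^`() + P * G) +
      P * ((1 - (w i)%:P * 'X) * g (w i) - (w i)%:P).
    by ring.
  by rewrite IHr gE; ring.
have /(congr1 (fun p : {poly F} => p`_m)) := PQ.
rewrite coefXnM ltnSn coefD coef_deriv => /eqP; rewrite addr_eq0 => /eqP ->.
congr (- _); rewrite mulrC coefM; apply: eq_bigr => l _; congr (_ * _).
by rewrite coef_sum; apply: eq_bigr => i _; rewrite coef_poly ltn_ord.
Qed.

(* Newton's identities propagate nonnegativity to all coefficients but the top
   one, which is [-1]; since [1] is a root, the others must vanish. *)
Lemma prod_eq_subrXn_of_powersums_le0 (F : numFieldType) (I : finType)
    (D : pred I) (w : I -> F) (m : nat) :
  #|D| = m.+1 -> ~~ odd m -> \prod_(i | D i) w i = 1 ->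
  (exists2 i, D i & w i = 1) ->
  (forall nu, (1 <= nu <= m)%N -> \sum_(i | D i) w i ^+ nu <= 0) ->
  \prod_(i | D i) (1 - (w i)%:P * 'X) = 1 - 'X^(m.+1).
Proof.
move=> cardD even_m prodw [i0 Di0 wi0] p_le0.
set P := \prod_(i | D i) _.
have wN0 i : D i -> w i != 0.
  move=> Di; apply: contra_eq_neq prodw => wi.
  by rewrite (bigD1 i) //= wi mul0r eq_sym oner_eq0.
have linE i : 1 - (w i)%:P * 'X = (- w i)%:P * 'X + 1%:P by rewrite polyCN mulNr addrC.
have size_lin i : D i -> size (1 - (w i)%:P * 'X) = 2%N.
  move=> Di; rewrite linE size_MXaddC polyC_eq0 oppr_eq0 (negPf (wN0 i Di)).
  by rewrite size_polyC oppr_eq0 wN0.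
have lead_lin i : D i -> lead_coef (1 - (w i)%:P * 'X) = - w i.
  by move=> Di; rewrite lead_coefE size_lin // linE !coefE /= addr0 mulr1.
have sizeP : size P = m.+2.
  rewrite /P size_prod => [|i Di]; last by rewrite -size_poly_eq0 size_lin.
  rewrite (eq_bigr (fun=> 2%N)) // sum_nat_const cardD; lia.
(* The leading coefficient is the product of the [- w i], and their number [m.+1] is odd. *)
have topP : P`_m.+1 = -1.
  have := lead_coefE P; rewrite sizeP /= => <-; rewrite lead_coef_prod.
  rewrite (eq_bigr (fun i => - w i)) // prodrN prodw cardD.
  by rewrite -signr_odd /= even_m mulr1.
have P0 : P`_0 = 1.
  rewrite -horner_coef0 horner_prod big1 // => i _.
  by rewrite !hornerE subr0.
have P_ge0 k : (k <= m)%N -> 0 <= P`_k.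
  elim/ltn_ind: k => -[_ _|k IHk km]; first by rewrite P0 ler01.
  rewrite -(pmulrn_lge0 _ (ltn0Sn k)) newton_identity oppr_ge0.
  apply: sumr_le0 => l _; rewrite mulr_le0_ge0 //.
    by apply: p_le0; have := ltn_ord l; lia.
  by apply: IHk; have := ltn_ord l; lia.
have sumP : \sum_(k < m) P`_k.+1 = 0.
  have : P.[1] = 0.
    by rewrite /P horner_prod (bigD1 i0) //= !hornerE wi0 subrr mul0r.
  rewrite horner_coef sizeP big_ord_recl big_ord_recr /= /bump /= !add1n.
  rewrite topP P0 !expr1n !mulr1 addrCA subrr addr0 => s0; rewrite -[RHS]s0.
  by apply: eq_bigr => k _; rewrite expr1n mulr1.
have P_mid k : (0 < k <= m)%N -> P`_k = 0.
  case: k => // k km.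
  exact: (psumr_eq0P (fun (i : 'I_m) _ => P_ge0 i.+1 (ltn_ord i)) sumP
    (i := Ordinal km)).
apply/polyP => k; rewrite coefB coef1 coefXn.
case: k => [|k]; first by rewrite P0 subr0.
rewrite sub0r; case: (ltngtP k m) => [km|km|->].
- by rewrite P_mid // eqSS ltn_eqF // oppr0.
- by rewrite nth_default ?sizeP // eqSS gtn_eqF // oppr0.
- by rewrite topP eqxx.
Qed.

(** * The exponential [e] and roots of unity *)

Section UnitCircle.
Variable R : realType.
Implicit Types x y : R.

Lemma eD x y : e (x + y) = e x * e y.
Proof.
rewrite /e mulrDr cosD sinD; apply/eqP; rewrite eq_complex /=.
by rewrite eqxx /= [X in _ == X]addrC (mulrC (sin _)) eqxx.
Qed.

Lemma e0 : e (0 : R) = 1.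
Proof. by rewrite /e mulr0 cos0 sin0. Qed.

Lemma e_neq0 x : e x != 0.
Proof.
by apply: contraTneq (oner_neq0 R[i]) => ex; rewrite -e0 -(subrr x) eD ex mul0r eqxx.
Qed.

Lemma eN x : e (- x) = (e x)^-1.
Proof. by apply: (mulIf (e_neq0 x)); rewrite -eD addNr e0 mulVf ?e_neq0. Qed.

Lemma e_mulrz x (a : int) : e (a%:~R * x) = e x ^ a.
Proof.
have nat_case (k : nat) : e (k%:R * x) = e x ^+ k.
  by elim: k => [|k IHk]; rewrite ?mul0r ?e0 // -natr1 mulrDl mul1r eD IHk exprSr.
case: a => k; first by rewrite -pmulrn nat_case.
by rewrite NegzE mulrNz mulNr eN -pmulrn nat_case.
Qed.

(** The real part is [1 - 2 sin(pi x)^2], and [sin (pi * x)] is positive on this interval. *)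
Lemma e_neq1 x : 0 < x < 1 -> e x != 1.
Proof.
move=> /andP[x0 x1]; rewrite eq_complex /= negb_and; apply/orP; left.
have -> : 2 * pi * x = (pi * x) *+ 2 by rewrite -[RHS]mulr_natl mulrA.
have s0 : 0 < sin (pi * x).
  by apply: sin_gt0_pi; rewrite mulr_gt0 ?pi_gt0 //= gtr_pMr ?pi_gt0.
have := cos2Dsin2 (pi * x).
rewrite mulr2n cosD -!expr2 => cs; apply/eqP => cs1.
have : sin (pi * x) ^+ 2 = 0 by lra.
by move/eqP; rewrite expf_eq0 /= gt_eqF.
Qed.

Lemma e_prim_root (M : nat) : (0 < M)%N -> M.-primitive_root (e (M%:R^-1 : R)).
Proof.
move=> M0; have MR : M%:R != 0 :> R by rewrite pnatr_eq0 -lt0n.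
apply/andP; split=> //; apply/forallP => i; apply/eqP.
rewrite unity_rootE exprnP -e_mulrz -pmulrn.
case: (ltngtP i.+1 M) => [iM|iM|->]; last 1 first.
- rewrite mulfV //; apply/eqP.
  by rewrite /e mulr1 mulr_natl cos2pi sin2pi.
- apply: negbTE; apply: e_neq1.
  by rewrite divr_gt0 ?ltr0n //= ltr_pdivrMr ?ltr0n // mul1r ltr_nat.
- by have := ltn_ord i; lia.
Qed.

Lemma normC_cabs (x : R[i]) : `|x| = (cabs x)%:C.
Proof. by []. Qed.

Lemma conjC_unit (x : R[i]) : cabs x = 1 -> (x^*)%R = x^-1.
Proof.
move=> x1; have x0 : x != 0 by rewrite -normr_eq0 normC_cabs x1 oner_eq0.
by apply: (mulfI x0); rewrite mulfV // -normCK normC_cabs x1 expr1n.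
Qed.

End UnitCircle.

(** Signed exponents are needed for differences [a_i - a_j]; periodicity reduces them to natural
    remainders modulo [M]. *)
Lemma eq_prim_root_exprz (F : fieldType) (M : nat) (zeta : F) (a b : int) :
  M.-primitive_root zeta -> (zeta ^ a == zeta ^ b) = (a == b %[mod M%:Z])%Z.
Proof.
move=> prim; have M0 := prim_order_gt0 prim.
have zM : zeta ^+ M = 1 := prim_expr_order prim.
have z0 : zeta != 0.
  by apply: contraTneq (oner_neq0 F) => z0; rewrite -zM z0 expr0n gtn_eqF // eqxx.
have red c : zeta ^ c = zeta ^+ `|(c %% M%:Z)%Z|%N.
  have c_ge0 : (0 <= c %% M%:Z)%Z by rewrite modz_ge0 // eqz_nat -lt0n.
  rewrite {1}(divz_eq c M%:Z) expfzDr // mulrC (mulrC _ M%:Z) -exprz_exp.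
  by rewrite -exprnP zM exp1rz mulr1 exprnP gez0_abs.
have ltM c : (`|(c %% M%:Z)%Z| < M)%N.
  have : (c %% M%:Z < M%:Z)%Z by rewrite ltz_mod // eqz_nat -lt0n.
  have : (0 <= c %% M%:Z)%Z by rewrite modz_ge0 // eqz_nat -lt0n.
  lia.
rewrite !red (eq_prim_root_expr prim) !modn_small //.
by rewrite -eqz_nat !gez0_abs // modz_ge0 // eqz_nat -lt0n.
Qed.

(** * The family of ratios [z_j / z_k] *)

(* The diagonal pair [(0, 0)] stands for the adjoined ratio [1]. *)
Definition offdiag0 (q : nat) : pred ('I_q.+1 * 'I_q.+1) :=
  fun p => (p.1 != p.2) || (p == (ord0, ord0)).

(** Isolating the full double sum lets it factor as a product when [f] is a product of a function of
    [j] and one of [k]. *)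
Lemma sum_offdiag0 (V : zmodType) (q : nat) (f : 'I_q.+1 * 'I_q.+1 -> V) :
  \sum_(p | offdiag0 p) f p =
  \sum_j \sum_k f (j, k) - \sum_j f (j, j) + f (ord0, ord0).
Proof.
rewrite (bigD1 (ord0, ord0)) /=; last by rewrite /offdiag0 eqxx orbT.
rewrite addrC; congr (_ + _); rewrite -sumrB.
under [RHS]eq_bigr => j _ do rewrite (bigD1 j) //= [X in X - _]addrC addrK.
rewrite pair_big_dep /=; apply: eq_big => [[j k]|[j k] //]; rewrite /offdiag0 /=.
rewrite xpair_eqE /= [k == j]eq_sym.
case: (eqVneq j k) => //= [->|]; first by case: (k == ord0).
by case: (eqVneq j ord0) => // ->; rewrite eq_sym => /negPf ->.
Qed.

Lemma card_offdiag0 (q : nat) : #|@offdiag0 q| = (q ^ 2 + q).+1.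
Proof.
apply/eqP; rewrite -eqz_nat -sum1_card -[X in X == _]natz natr_sum sum_offdiag0; apply/eqP.
rewrite !sumr_const !card_ord; lia.
Qed.

(** Swapping coordinates preserves [offdiag0], so numerators and denominators have the same
    product. *)
Lemma prod_offdiag0_ratio (F : fieldType) (q : nat) (z : 'I_q.+1 -> F) :
  (forall k, z k != 0) -> \prod_(p | offdiag0 p) (z p.1 / z p.2) = 1.
Proof.
move=> z0; rewrite prodf_div.
rewrite (reindex_inj (h := swap_pair) (can_inj (g := swap_pair) _)) /=;
  last by case.
rewrite (eq_bigl (@offdiag0 q)); last first.
  by move=> [j k]; rewrite /offdiag0 /= eq_sym !xpair_eqE andbC.
by rewrite divff //; apply/prodf_neq0 => p _.
Qed.

(** On the unit circle inverses are conjugates, so the full double sum is [|S(nu)|^2]; trading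
    [q.+1] diagonal ones for a single one subtracts [q]. *)
Lemma powersum_offdiag0_ratio (R : realType) (q : nat) (z : 'I_q.+1 -> R[i]) nu :
  (forall k, cabs (z k) = 1) ->
  \sum_(p | offdiag0 p) (z p.1 / z p.2) ^+ nu =
  (cabs (powersum z nu) ^+ 2 - q%:R)%:C.
Proof.
move=> z1; have z0 k : z k != 0 by rewrite -normr_eq0 normC_cabs z1 oner_eq0.
rewrite sum_offdiag0 /= (divff (z0 _)) expr1n.
under [X in _ - X + _]eq_bigr => j _ do rewrite (divff (z0 _)) expr1n.
rewrite sumr_const card_ord rmorphB rmorphXn rmorph_nat /= -normC_cabs normCK.
rewrite -natr1 opprD addrA addrNK; congr (_ - _).
rewrite {2}/powersum rmorph_sum /powersum big_distrlr /=.
apply: eq_bigr => j _; apply: eq_bigr => k _.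
by rewrite rmorphXn /= conjC_unit // exprMn.
Qed.

(** * The two implications *)

(** Assuming upper bounds instead of equalities makes this serve both (i) -> (ii) and, by
    contraposition, the strict bound on the maximum. *)
Lemma perfect_difference_set_of_powersum_le (R : realType) (q : nat)
    (z : 'I_q.+1 -> R[i]) :
  (forall k, cabs (z k) = 1) ->
  (forall nu, (1 <= nu <= q ^ 2 + q)%N ->
     cabs (powersum z nu) <= Num.sqrt q%:R) ->
  exists (alpha : R[i]) (a : q.+1.-tuple int),
    [/\ cabs alpha = 1, perfect_difference_set a
      & forall k : 'I_q.+1,
          z k = alpha * e ((nth 0 a k)%:~R / (q ^ 2 + q + 1)%N%:R)].
Proof.
move=> z1 leS; have z0 k : z k != 0 by rewrite -normr_eq0 normC_cabs z1 oner_eq0.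
pose w (p : 'I_q.+1 * 'I_q.+1) := z p.1 / z p.2.
have w0 p : w p != 0 by rewrite mulf_neq0 ?invr_eq0.
have PE : \prod_(p | offdiag0 p) (1 - (w p)%:P * 'X) = 1 - 'X^((q ^ 2 + q).+1).
  apply: prod_eq_subrXn_of_powersums_le0.
  - exact: card_offdiag0.
  - by rewrite oddD oddX /= addbb.
  - exact: prod_offdiag0_ratio.
  - by exists (ord0, ord0); rewrite /offdiag0 ?eqxx ?orbT // /w divff.
  move=> nu nuP; rewrite powersum_offdiag0_ratio // lecR subr_le0.
  rewrite -(sqr_sqrtr (ler0n R q)) ler_pXn2r ?nnegrE ?sqrtr_ge0 //.
    exact: leS.
  by rewrite -lecR -normC_cabs normr_ge0.
rewrite addn1; set M := (q ^ 2 + q).+1 in PE *.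
have prim := e_prim_root R (ltn0Sn _ : (0 < M)%N).
set zeta := e _ in prim.
(* Evaluating [PE] at the inverse of a ratio kills one factor on the left. *)
have w_root k : (z k / z ord0) ^+ M = 1.
  have Dk : offdiag0 (k, ord0).
    by rewrite /offdiag0 /= xpair_eqE eqxx andbT orNb.
  have := congr1 (fun p => p.[(w (k, ord0))^-1]) PE.
  rewrite horner_prod (bigD1 (k, ord0)) //= !hornerE divff // subrr mul0r.
  move=> /esym/eqP; rewrite subr_eq0 exprVn => /eqP/esym/(canRL invrK).
  by rewrite invr1.
(* Conversely, [1 - 'X^M] vanishes at [x^-1], so some factor does too. *)
have cover (x : R[i]) : x ^+ M = 1 -> exists2 p, offdiag0 p & w p = x.
  move=> xM; have x0 : x != 0.
    by apply: contraTneq (oner_neq0 R[i]) => x0; rewrite -xM x0 expr0n eqxx.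
  have := congr1 (fun p => p.[x^-1]) PE.
  rewrite horner_prod !hornerE exprVn xM invr1 subrr.
  move=> /eqP/prodf_eq0[p Dp]; rewrite !hornerE subr_eq0 => /eqP wx.
  by exists p => //; apply: (mulIf (invr_neq0 x0)); rewrite -wx divff.
(* With [alpha = z ord0], the entries are the exponents of [z k / z ord0] as powers of [zeta]. *)
pose a : q.+1.-tuple int :=
  [tuple (sval (prim_rootP prim (w_root k)))%:Z | k < q.+1].
have aE k : z k = z ord0 * zeta ^ (tnth a k).
  rewrite tnth_mktuple -exprnP; case: prim_rootP => i /= <-.
  by rewrite mulrC divfK.
exists (z ord0), a; split=> // [r Mr|k]; last by rewrite -tnth_nth aE e_mulrz.
rewrite addn1 -/M in Mr *.
have [|[j k] Djk wjk] := cover (zeta ^ r).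
  by rewrite exprnP exprzAC -exprnP (prim_expr_order prim) exp1rz.
have zeta0 : zeta != 0 by exact: e_neq0.
have wE : w (j, k) = zeta ^ (tnth a j - tnth a k).
  by rewrite /w /= (aE j) (aE k) invfM mulrACA divff // mul1r expfzDr // invr_expz.
exists j, k; split; last first.
  by apply/eqP; rewrite -(eq_prim_root_exprz _ _ prim) -wE wjk.
(* A diagonal pair would give [zeta ^ r = 1], hence [M] dividing [r]. *)
apply: contraNneq Mr => jk; rewrite -(subr0 r) -eqz_mod_dvd.
by rewrite -(eq_prim_root_exprz _ _ prim) -wjk wE jk subrr eqxx.
Qed.

(** The [M] pairs of [offdiag0] reach all [M] residues, [(ord0, ord0)] giving 0, hence each exactly
    once. The ratios thus run once through the [M]-th roots of unity. *)
Lemma powersum_of_perfect_difference_set (R : realType) (q : nat)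
    (z : 'I_q.+1 -> R[i]) (alpha : R[i]) (a : q.+1.-tuple int) (nu : nat) :
  (forall k, cabs (z k) = 1) -> perfect_difference_set a ->
  (forall k : 'I_q.+1,
     z k = alpha * e ((nth 0 a k)%:~R / (q ^ 2 + q + 1)%N%:R)) ->
  (1 <= nu <= q ^ 2 + q)%N ->
  cabs (powersum z nu) = Num.sqrt q%:R.
Proof.
move=> z1; have z0 k : z k != 0 by rewrite -normr_eq0 normC_cabs z1 oner_eq0.
rewrite /perfect_difference_set addn1; set M := (q ^ 2 + q).+1.
move=> pds zE nuP; have prim := e_prim_root R (ltn0Sn _ : (0 < M)%N).
set zeta := e _ in prim.
have zeta0 : zeta != 0 by exact: e_neq0.
pose d (p : 'I_q.+1 * 'I_q.+1) := tnth a p.1 - tnth a p.2.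
have alpha0 : alpha != 0.
  by apply: contraTneq (z0 ord0) => al; rewrite zE al mul0r eqxx.
have wE p : z p.1 / z p.2 = zeta ^ d p.
  rewrite !zE !e_mulrz -!tnth_nth invfM mulrACA divff // mul1r expfzDr //.
  by rewrite invr_expz.
pose f p : 'I_M := inord `|(d p %% M%:Z)%Z|.
have dM p : (0 <= d p %% M%:Z)%Z && (d p %% M%:Z < M%:Z)%Z.
  by rewrite modz_ge0 // ltz_mod.
have fE p : (f p)%:Z = (d p %% M%:Z)%Z.
  by have := dM p; rewrite /f inordK; lia.
have zetaf p : zeta ^ d p = zeta ^+ f p.
  apply/eqP; rewrite exprnP (eq_prim_root_exprz _ _ prim) fE.
  by rewrite modz_mod.
have f_onto : [set f p | p in @offdiag0 q] = setT.
  apply/setP => i; rewrite inE; apply/imsetP.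
  have [i0|i0] := eqVneq (i : nat) 0%N.
    exists (ord0, ord0); first by rewrite unfold_in /offdiag0 eqxx orbT.
    by apply/ord_inj/eqP; rewrite -eqz_nat fE i0 /d subrr mod0z.
  have [|j [k [jk /eqP djk]]] := pds i%:Z.
    by rewrite dvdzE /= gtnNdvd // lt0n.
  exists (j, k); first by rewrite unfold_in /offdiag0 jk.
  apply/ord_inj/eqP; rewrite -eqz_nat fE (eqP djk) modz_small //.
  by have := ltn_ord i; lia.
have f_inj : {in @offdiag0 q &, injective f}.
  by apply/imset_injP; rewrite f_onto cardsT card_ord card_offdiag0.
have : \sum_(p | offdiag0 p) (z p.1 / z p.2) ^+ nu = 0.
  under eq_bigr => p _ do rewrite wE zetaf.
  rewrite -(big_imset (fun i : 'I_M => (zeta ^+ i) ^+ nu) f_inj) f_onto.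
  under eq_bigr => i _ do rewrite exprAC.
  (* The geometric sum of [zeta ^+ nu] vanishes because [zeta ^+ nu != 1] for [0 < nu < M]. *)
  have /eqP := subrX1 (zeta ^+ nu) M.
  rewrite exprAC (prim_expr_order prim) expr1n subrr eq_sym mulf_eq0.
  case/orP=> [|/eqP s0].
    rewrite subr_eq0 -(prim_order_dvd prim) => /dvdn_leq; lia.
  by rewrite -[RHS]s0; apply: eq_bigl => i; rewrite inE.
rewrite powersum_offdiag0_ratio // => /complexI/eqP; rewrite subr_eq0 => /eqP <-.
by rewrite sqrtr_sqr ger0_norm // -lecR -normC_cabs normr_ge0.
Qed.

Theorem theorem1 (R : realType) (n : nat) (hn : (1 <= n)%N)
    (z : 'I_n -> R[i]) (hz : forall k : 'I_n, cabs (z k) = 1) :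
  let cond_i :=
    forall nu : nat, (1 <= nu <= n ^ 2 - n)%N ->
      cabs (powersum z nu) = Num.sqrt (n%:R - 1) in
  let cond_ii :=
    exists (alpha : R[i]) (a : n.-1.+1.-tuple int),
      [/\ cabs alpha = 1,
          perfect_difference_set a
        & forall k : 'I_n,
            z k = alpha * e ((nth 0 a k)%:~R / (n ^ 2 - n + 1)%N%:R)] in
  (cond_i <-> cond_ii) /\
  (~ cond_i /\ ~ cond_ii ->
    Num.sqrt (n%:R - 1) < max_powersum z (n ^ 2 - n)).
Proof.
case: n hn z hz => // q _ z z1 /=.
have -> : (q.+1 ^ 2 - q.+1 = q ^ 2 + q)%N by lia.
have -> : q.+1%:R - 1 = q%:R :> R by rewrite -natr1 addrK.
split; first split.
- move=> i; apply: perfect_difference_set_of_powersum_le => // nu nuP.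
  by rewrite i.
- move=> [alpha [a [_ pds zE]]] nu; exact: powersum_of_perfect_difference_set pds zE.
(* A maximum of at most [Num.sqrt q%:R] would bound every [|S(nu)|] and so force (ii). *)
- move=> [_ nii]; rewrite ltNge; apply/negP => le_max; apply: nii.
  apply: perfect_difference_set_of_powersum_le => // nu nuP.
  apply: le_trans le_max; rewrite /max_powersum.
  by apply: (le_bigmax_seq _ nu xpredT (fun nu => cabs (powersum z nu)));
    rewrite // mem_index_iota.
Qed.
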